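(* Let $(N,M,\boldsymbol q)$ be a setting and let $(\varphi,\psi)$ be a hybrid-admissible pair of mechanisms in this setting. For $\beta\in[0,1]$ let $h^{\beta}=(1-\beta)\varphi+\beta\psi$ be the $\beta$-hybrid. Then: 1. for any $r\in[0,1)$ there exists $\beta\in(0,1]$ such that $h^{\beta}$ is $r$-partially strategyproof; 2. the mapping $\beta\mapsto\rho_{(N,M,\boldsymbol q)}(h^{\beta})$ on $[0,1]$ is monotonic and (weakly) decreasing, where $\rho_{(N,M,\boldsymbol q)}$ denotes the degree of strategyproofness.
   Context: A setting $(N,M,\boldsymbol q)$ consists of a finite set $N$ of $n$ agents, a finite set $M$ of $m$ objects, and a vector $\boldsymbol q=(q_j)_{j\in M}$ of capacities (positive integers; there are $q_j$ units of object $j$) with $n\le\sum_{j\in M}q_j$. $\mathcal P$ is the set of strict preference orders (linear orders) over $M$; $P:a\succ b$ means that $a$ is strictly preferred to $b$ under $P$. A preference profile is an element $(P_i,P_{-i})\in\mathcal P^N$, where $P_{-i}$ are the orders of all agents except $i$. A utility function $u:M\to\mathbb R^+$ is consistent with $P$ if $u(a)>u(b)$ whenever $P:a\succ b$; $U_P$ is the set of utility functions consistent with $P$. An assignment is an $N\times M$ matrix $x$ with $x_{i,j}\in[0,1]$, $\sum_{j\in M}x_{i,j}=1$ for all $i\in N$, and $\sum_{i\in N}x_{i,j}\le q_j$ for all $j\in M$; $\Delta(X)$ is the set of assignments. A mechanism is a map $\varphi:\mathcal P^N\to\Delta(X)$; $\varphi_i(P_i,P_{-i})$ is the row of agent $i$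 (its assignment), with entries $\varphi_{i,j}(P_i,P_{-i})$. Hybrids are defined pointwise: $h^\beta(\boldsymbol P)=(1-\beta)\varphi(\boldsymbol P)+\beta\psi(\boldsymbol P)$. Write $\langle u,v\rangle=\sum_{j\in M}u(j)v_j$. $\varphi$ is strategyproof if $\langle u_i,\varphi_i(P_i,P_{-i})-\varphi_i(P_i',P_{-i})\rangle\ge0$ for all $i\in N$, $(P_i,P_{-i})\in\mathcal P^N$, $P_i'\in\mathcal P$, $u_i\in U_{P_i}$. For $r\in[0,1]$, $u\in U_P$ satisfies URBI($r$) if for all $a,b\in M$ with $P:a\succ b$ we have $r\,(u(a)-\min_{j\in M}u(j))\ge u(b)-\min_{j\in M}u(j)$. A mechanism is $r$-partially strategyproof (in the setting) if the inequality in the definition of strategyproofness holds for all $i$, $(P_i,P_{-i})$, $P_i'$, and all $u_i\in U_{P_i}$ satisfying URBI($r$); by convention every mechanism is $0$-partially strategyproof. The degree of strategyproofness is $\rho_{(N,M,\boldsymbol q)}(\varphi)=\max\{r\in[0,1]:\varphi\text{ is }r\text{-partially strategyproof}\}$. The neighborhood $N_P$ of $P\in\mathcal P$ is the set of orders obtained from $P$ by swapping two objects that are adjacent in $P$. A mechanism $\psi$ is upper invariant if for all $i$, $(P_i,P_{-i})$, and $P_i'\in N_{P_i}$ with $P_i:a\succ b$ and $P_i':b\succ a$, we have $\psi_{i,j}(P_i,P_{-i})=\psi_{i,j}(P_i',P_{-i})$ for all $j\in M$ with $P_i:j\succ a$. $\psi$ is weakly less varying than $\varphi$ if for all $i$,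 $(P_i,P_{-i})$, and $P_i'\in N_{P_i}$: $\varphi_i(P_i,P_{-i})=\varphi_i(P_i',P_{-i})$ implies $\psi_i(P_i,P_{-i})=\psi_i(P_i',P_{-i})$. The pair $(\varphi,\psi)$ is hybrid-admissible if (1) $\varphi$ is strategyproof, (2) $\psi$ is upper invariant, (3) $\psi$ is weakly less varying than $\varphi$. *)

(* Defs.v *)
From HB Require Import structures.
From mathcomp Require Import all_boot all_order all_algebra all_fingroup.
From mathcomp Require Import boolp classical_sets reals ring lra.
Set Implicit Arguments.
Unset Strict Implicit.
Unset Printing Implicit Defensive.
Import Order.TTheory GRing.Theory Num.Theory.
Local Open Scope ring_scope.

Definition strict_linear_order (M : finType) (P : {set M * M}) : bool :=
  [&& [forall a, (a, a) \notin P],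
      [forall a, forall b, forall c,
         ((a, b) \in P) && ((b, c) \in P) ==> ((a, c) \in P)]
    & [forall a, forall b, (a != b) ==> ((a, b) \in P) || ((b, a) \in P)]].

Definition pref (M : finType) : finType :=
  {P : {set M * M} | strict_linear_order P}.

Definition prefers (M : finType) (P : pref M) (a b : M) : bool :=
  (a, b) \in val P.

Lemma prefers_irr (M : finType) (P : pref M) a : prefers P a a = false.
Proof.
by case: P => P h; rewrite /prefers /=; case/and3P: h => /forallP/(_ a)/negbTE.
Qed.

Lemma prefers_trans (M : finType) (P : pref M) a b c :
  prefers P a b -> prefers P b c -> prefers P a c.
Proof.
case: P => P h; rewrite /prefers /=; case/and3P: h => _ h _ ab bc.
by move/forallP/(_ a)/forallP/(_ b)/forallP/(_ c): h; rewrite ab bc.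
Qed.

Definition profile (N M : finType) : finType := {ffun N -> pref M}.

Definition deviate (N M : finType) (p : profile N M) (i : N) (P' : pref M) :
    profile N M :=
  [ffun k => if k == i then P' else p k].

Definition adjacent (M : finType) (P : pref M) (a b : M) : Prop :=
  prefers P a b /\ ~ exists c : M, prefers P a c /\ prefers P c b.

Definition neighbor (M : finType) (P P' : pref M) : Prop :=
  exists a b : M, adjacent P a b /\
    forall x y : M, prefers P' x y = prefers P (tperm a b x) (tperm a b y).

Section Mechanisms.
Variables (R : realType) (N M : finType).

Definition assignment (q : M -> nat) (x : N -> M -> R) : Prop :=
  [/\ forall i j, 0 <= x i j <= 1,
      forall i, \sum_(j : M) x i j = 1
    & forall j, \sum_(i : N) x i j <= (q j)%:R].

(* Row i of [phi p] is the assignment of agent i; feasibility is the separate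
   predicate [mechanism]. *)
Definition mechanism (q : M -> nat) (phi : profile N M -> N -> M -> R) : Prop :=
  forall p, assignment q (phi p).

Definition hybrid (beta : R) (phi psi : profile N M -> N -> M -> R) :
    profile N M -> N -> M -> R :=
  fun p i j => (1 - beta) * phi p i j + beta * psi p i j.

Lemma hybrid_mechanism (q : M -> nat) (beta : R) phi psi :
  0 <= beta <= 1 -> mechanism q phi -> mechanism q psi ->
  mechanism q (hybrid beta phi psi).
Proof.
move=> /andP[b0 b1] hphi hpsi p; have [x01 xr xc] := hphi p.
have [y01 yr yc] := hpsi p; have b1' : 0 <= 1 - beta by rewrite subr_ge0.
rewrite /hybrid; split=> [i j|i|j].
- have /andP[x0 x1] := x01 i j; have /andP[y0 y1] := y01 i j.
  rewrite addr_ge0 ?mulr_ge0 //= -[leRHS](subrK beta).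
  by rewrite lerD // ler_piMr.
- by rewrite big_split /= -!mulr_sumr xr yr !mulr1 subrK.
- rewrite big_split /= -!mulr_sumr.
  apply: (@le_trans _ _ ((1 - beta) * (q j)%:R + beta * (q j)%:R)).
    by rewrite lerD // ler_wpM2l.
  by rewrite -mulrDl subrK mul1r.
Qed.

(* [R^+] is read as the nonnegative reals. *)
Definition consistent (P : pref M) (u : M -> R) : Prop :=
  (forall a, 0 <= u a) /\ (forall a b, prefers P a b -> u b < u a).

Definition inner (u v : M -> R) : R := \sum_(j : M) u j * v j.

Definition no_gain (phi : profile N M -> N -> M -> R)
    (i : N) (p : profile N M) (P' : pref M) (u : M -> R) : Prop :=
  0 <= inner u (fun j => phi p i j - phi (deviate p i P') i j).

Definition strategyproof (phi : profile N M -> N -> M -> R) : Prop :=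
  forall (i : N) (p : profile N M) (P' : pref M) (u : M -> R),
    consistent (p i) u -> no_gain phi i p P' u.

(* The seed [u a] is itself a value of u, so the iterated minimum is the
   minimum of u over M. *)
Definition URBI (r : R) (P : pref M) (u : M -> R) : Prop :=
  forall a b : M, prefers P a b ->
    let umin := \big[Num.min/u a]_(j : M) u j in
    u b - umin <= r * (u a - umin).

(* The disjunct [r = 0] is a genuine convention: when #|M| = 2, every consistent
   utility function satisfies URBI(0). *)
Definition partially_strategyproof (r : R)
    (phi : profile N M -> N -> M -> R) : Prop :=
  r = 0 \/
  forall (i : N) (p : profile N M) (P' : pref M) (u : M -> R),
    consistent (p i) u -> URBI r (p i) u -> no_gain phi i p P' u.

Definition psp_levels (phi : profile N M -> N -> M -> R) : set R :=
  [set r | 0 <= r <= 1 /\ partially_strategyproof r phi]%classic.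

(* The supremum is attained: see [degree_max]. *)
Definition degree (phi : profile N M -> N -> M -> R) : R :=
  sup (psp_levels phi).

Lemma URBI_minE (r m : R) (P : pref M) (u : M -> R) (k : M) :
  u k = m -> (forall j, m <= u j) ->
  URBI r P u <-> forall a b, prefers P a b -> u b - m <= r * (u a - m).
Proof.
move=> uk um.
have E a : \big[Num.min/u a]_(j : M) u j = m.
  apply/eqP; rewrite eq_le -{1}uk bigmin_le /=.
  by apply/bigmin_geP; split=> [|j _]; exact: um.
by split=> h a b ab; have := h a b ab; rewrite /= ?E.
Qed.

Lemma inner_shift (u d : M -> R) (c : R) :
  \sum_j d j = 0 -> inner (fun j => u j - c) d = inner u d.
Proof.
move=> d0; rewrite /inner.
under eq_bigr do rewrite mulrBl.
by rewrite sumrB -mulr_sumr d0 mulr0 subr0.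
Qed.

Definition rank (P : pref M) (j : M) : nat := #|[pred k | prefers P k j]|.

Lemma rank_lt (P : pref M) a b : prefers P a b -> (rank P a < rank P b)%N.
Proof.
move=> ab; apply: proper_card; apply/fintype.properP; split.
  by apply/fintype.subsetP => k; rewrite !inE => ka; exact: prefers_trans ka ab.
by exists a; rewrite !inE ?prefers_irr.
Qed.

Lemma bernoulli (e : R) n : 0 <= e <= 1 -> 1 - (1 - e) ^+ n <= n%:R * e.
Proof.
move=> /andP[e0 e1]; elim: n => [|n IH]; first by rewrite mul0r expr0 subrr.
have x1 : (1 - e) ^+ n <= 1 by rewrite exprn_ile1 ?subr_ge0 // gerBl.
by rewrite exprS -natr1; nra.
Qed.

Lemma URBI_weaken (r r' : R) (P : pref M) (u : M -> R) :
  r <= r' -> URBI r P u -> URBI r' P u.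
Proof.
move=> rr' h a b ab /=; apply: le_trans (h a b ab) _.
by rewrite ler_wpM2r // subr_ge0; exact: bigmin_le.
Qed.

Lemma psp_closed (q : M -> nat) (phi : profile N M -> N -> M -> R) (s : R) :
  mechanism q phi -> 0 < s ->
  (forall t, t < s -> exists2 r, psp_levels phi r & t < r) ->
  partially_strategyproof s phi.
Proof.
move=> mphi s0 hs; right=> i p P' u [u0 uP] uU; rewrite /no_gain.
set d := fun j => _.
have d0 : \sum_j d j = 0.
  rewrite /d sumrB; have [_ -> _] := mphi p.
  by have [_ -> _] := mphi (deviate p i P'); rewrite subrr.
have [j0 _|M0] := pickP (fun _ : M => true); last first.
  by rewrite /inner big_pred0.
have [k um] : exists k, forall j, u k <= u j.
  by case: (@arg_minP _ _ _ j0 xpredT u isT) => k _ h; exists k => j; exact: h.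
move/(URBI_minE s (p i) (erefl (u k)) um): uU => uU.
rewrite -(inner_shift u (u k) d0).
set w := fun j => u j - u k.
have w0 j : 0 <= w j by rewrite subr_ge0.
pose rk := rank (p i).
have hv e : 0 < e < 1 -> 0 <= inner (fun j => (1 - e) ^+ rk j * w j) d.
  move=> /andP[e0 e1].
  have t0 : 0 < 1 - e by rewrite subr_gt0.
  have t1 : 1 - e <= 1 by rewrite gerBl ltW.
  have ts : (1 - e) * s < s by rewrite gtr_pMl // ltrBlDr ltrDl.
  have [r [_ [r0|hr]] tr] := hs _ ts.
    by move: tr; rewrite r0 ltNge mulr_ge0 // ltW.
  set v := fun j => _.
  have v0 j : 0 <= v j by rewrite mulr_ge0 // exprn_ge0 // ltW.
  have vk : v k = 0 by rewrite /v /w subrr mulr0.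
  apply: hr.
    split=> // a b ab; rewrite /v.
    have wab : w b < w a by rewrite ltrD2r uP.
    apply: (@le_lt_trans _ _ ((1 - e) ^+ rk a * w b)).
      by rewrite ler_wpM2r // ler_wiXn2l ?(ltnW (rank_lt ab)) ?(ltW t0).
    by rewrite ltr_pM2l // exprn_gt0.
  apply: (URBI_weaken (ltW tr)).
  apply/(URBI_minE _ _ vk v0) => a b ab; rewrite !subr0 /v.
  apply: (@le_trans _ _ ((1 - e) ^+ (rk a).+1 * w b)).
    by rewrite ler_wpM2r ?ler_wiXn2l ?(rank_lt ab) ?(ltW t0).
  have -> : (1 - e) * s * ((1 - e) ^+ rk a * w a) =
     (1 - e) ^+ (rk a).+1 * (s * w a) by rewrite exprS; ring.
  by rewrite ler_wpM2l ?uU // exprn_ge0 // ltW.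
pose C := \sum_j `|w j * d j| * (rk j)%:R.
have C0 : 0 <= C by apply: sumr_ge0 => j _; rewrite mulr_ge0.
have key e : 0 < e < 1 -> - (C * e) <= inner w d.
  move=> e01; have /andP[/ltW e0 /ltW e1] := e01.
  apply: (@le_trans _ _ (inner w d - inner (fun j => (1 - e) ^+ rk j * w j) d)); last first.
    by rewrite gerBl hv.
  rewrite /inner -sumrB /C mulr_suml -sumrN; apply: ler_sum => j _.
  have -> : w j * d j - (1 - e) ^+ rk j * w j * d j =
      (w j * d j) * (1 - (1 - e) ^+ rk j) by ring.
  have b0 : 0 <= 1 - (1 - e) ^+ rk j.
    by rewrite subr_ge0 exprn_ile1 // ?subr_ge0 // gerBl.
  rewrite -mulrA lerNl -mulNr.
  apply: (@le_trans _ _ (`|w j * d j| * (1 - (1 - e) ^+ rk j))).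
    by rewrite ler_wpM2r // -normrN ler_norm.
  by rewrite ler_wpM2l // bernoulli // e0.
rewrite leNgt; apply/negP => A0.
set A := inner w d in key A0.
have D0 : 0 < 1 + C - A by lra.
have := key (- A / (1 + C - A)).
rewrite divr_gt0 ?oppr_gt0 //= ltr_pdivrMr // mulrA => /(_ _)/wrap[].
  by lra.
by rewrite lerNl ler_pdivlMr //; nra.
Qed.

Lemma degree_max (q : M -> nat) (phi : profile N M -> N -> M -> R) :
  mechanism q phi ->
  psp_levels phi (degree phi) /\
  (forall r, psp_levels phi r -> r <= degree phi).
Proof.
move=> mphi.
have S0 : psp_levels phi 0 by split; [rewrite lexx ler01|left].
have ub : ubound (psp_levels phi) 1 by move=> r [/andP[]].
have hsup : has_sup (psp_levels phi) by split; [exists 0|exists 1].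
have le_deg r : psp_levels phi r -> r <= degree phi.
  by move=> hr; apply: sup_upper_bound.
split=> //; have deg0 := le_deg _ S0; split.
  by rewrite deg0 ge_sup //; exists 0.
have [->|dn0] := eqVneq (degree phi) 0; first by left.
apply: (psp_closed mphi) => [|t td]; first by rewrite lt_def dn0.
by apply: sup_gt => //; exists 0.
Qed.

Definition upper_invariant (psi : profile N M -> N -> M -> R) : Prop :=
  forall (i : N) (p : profile N M) (P' : pref M), neighbor (p i) P' ->
  forall a b : M, prefers (p i) a b -> prefers P' b a ->
  forall j : M, prefers (p i) j a -> psi p i j = psi (deviate p i P') i j.

Definition weakly_less_varying (psi phi : profile N M -> N -> M -> R) : Prop :=
  forall (i : N) (p : profile N M) (P' : pref M), neighbor (p i) P' ->
    phi p i =1 phi (deviate p i P') i -> psi p i =1 psi (deviate p i P') i.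

Definition hybrid_admissible (phi psi : profile N M -> N -> M -> R) : Prop :=
  [/\ strategyproof phi, upper_invariant psi & weakly_less_varying psi phi].

End Mechanisms.

(* Main.v *)
(* Fix an agent and the reports of the others, and let d and e be the changes
   of its assignment under phi and psi when it reports Q instead of its true
   order P.  Strategyproofness makes phi(P) stochastically dominate phi(Q), so
   the P-best object k with d k != 0 has d k > 0.  Sorting Q towards P by
   adjacent swaps, first those involving the objects ranked above k, phi stays
   constant as long as one of these objects moves up; hence so does psi, and
   the remaining swaps do not affect psi on these objects by upper invariance.
   Therefore e vanishes above k.  For a utility u satisfying URBI(r), the loss
   under phi is at least (1 - r) / 2 * (u k - min u) * d k while the gain under
   psi is at most a constant times u k - min u, so a small enough weight on psi
   works; there are only finitely many triples (agent, profile, misreport). *)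
Require Import Defs.
From mathcomp Require Import all_boot all_order all_algebra all_fingroup.
From mathcomp Require Import boolp reals ring lra.
Set Implicit Arguments.
Unset Strict Implicit.
Unset Printing Implicit Defensive.
Import Order.TTheory GRing.Theory Num.Theory.
Local Open Scope ring_scope.

(** * Linear orders, adjacent swaps and inversions *)

Section Preferences.
Variable M : finType.
Implicit Types (P Q : pref M) (a b x y : M) (S T : {set M}).

Lemma prefers_total P a b : a != b -> prefers P a b || prefers P b a.
Proof.
case: P => P h; rewrite /prefers /=; case/and3P: h => _ _.
by move=> /forallP/(_ a)/forallP/(_ b)/implyP.
Qed.

Lemma prefers_asym P a b : prefers P a b -> prefers P b a = false.
Proof.
by move=> ab; apply/negP => /(prefers_trans ab); rewrite prefers_irr.
Qed.

Lemma pref_ext P Q : (forall a b, prefers P a b -> prefers Q a b) -> P = Q.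
Proof.
move=> h; apply/val_inj/setP => -[a b].
apply/idP/idP; first exact: h.
move=> qab; apply/negPn/negP => npab.
have ab : a != b by apply: contraTneq qab => ->; rewrite -/(prefers Q b b) prefers_irr.
case/orP: (prefers_total P ab) => [pab|/h /prefers_asym qba].
  by move: npab; rewrite -/(prefers P a b) pab.
by move: qab; rewrite -/(prefers Q a b) qba.
Qed.

Definition swap_set P y x : {set M * M} :=
  [set z | prefers P (tperm y x z.1) (tperm y x z.2)].

Lemma swap_subproof P y x : strict_linear_order (swap_set P y x).
Proof.
apply/and3P; split.
- by apply/forallP => a; rewrite inE prefers_irr.
- apply/forallP => a; apply/forallP => b; apply/forallP => c.
  by rewrite !inE /=; apply/implyP => /andP[]; exact: prefers_trans.
- apply/forallP => a; apply/forallP => b; apply/implyP => ab.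
  by rewrite !inE /= prefers_total // (inj_eq perm_inj).
Qed.

(** Applied when [adjacent P y x] holds: the lower object [x] then moves up past [y]. *)
Definition swap P y x : pref M := exist _ (swap_set P y x) (swap_subproof P y x).

Lemma prefers_swap P y x a b :
  prefers (swap P y x) a b = prefers P (tperm y x a) (tperm y x b).
Proof. by rewrite {1}/prefers inE. Qed.

Lemma neighbor_swap P y x : adjacent P y x -> neighbor P (swap P y x).
Proof. by move=> yx; exists y, x; split=> // a b; rewrite prefers_swap. Qed.

Section Adjacent.
Variables (P : pref M) (y x : M).
Hypothesis yx : adjacent P y x.

Lemma adjacent_neq : y != x.
Proof. by case: yx => + _; apply: contraTneq => ->; rewrite prefers_irr. Qed.

Lemma prefers_adjl b : b != x -> b != y -> prefers P x b = prefers P y b.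
Proof.
case: yx => pyx nc bx by_; apply/idP/idP; first exact: prefers_trans.
move=> yb; case/orP: (prefers_total P bx) => // bx'.
by case: nc; exists b.
Qed.

Lemma prefers_adjr b : b != x -> b != y -> prefers P b x = prefers P b y.
Proof.
case: yx => pyx nc bx by_; apply/idP/idP => [bx'|b_y]; last exact: prefers_trans pyx.
case/orP: (prefers_total P by_) => // yb.
by case: nc; exists b.
Qed.

(** No object lies between [y] and [x], so all others compare alike with both and only this pair is
    reversed. *)
Lemma prefers_swap_adj a b : prefers (swap P y x) a b =
  ((a, b) == (x, y)) || ((a, b) != (y, x)) && prefers P a b.
Proof.
have nyx := adjacent_neq; have [pyx _] := yx.
rewrite prefers_swap !xpair_eqE.
case: (tpermP y x a) => [->|->|/eqP ay /eqP ax];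
  case: (tpermP y x b) => [->|->|/eqP by_ /eqP bx];
  rewrite ?eqxx ?prefers_irr ?(negPf nyx) 1?[x == y]eq_sym ?(negPf nyx) //=
    ?(prefers_asym pyx) ?(negPf ay) ?(negPf ax) ?(negPf by_) ?(negPf bx)
    ?prefers_adjl ?prefers_adjr //.
Qed.

End Adjacent.

Definition upper_set P S : Prop := forall a b, prefers P a b -> b \in S -> a \in S.

Lemma upper_above P x : upper_set P [set j | prefers P j x].
Proof. by move=> a b ab; rewrite !inE; exact: prefers_trans. Qed.

Lemma upper_setU1_above P x : upper_set P (x |: [set j | prefers P j x]).
Proof.
move=> a b ab; rewrite !inE => /orP[/eqP <-|bx]; first by rewrite ab orbT.
by rewrite (prefers_trans ab bx) orbT.
Qed.

Lemma upper_swap P y x S : adjacent P y x -> upper_set P S ->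
  (y \in S -> x \in S) -> upper_set (swap P y x) S.
Proof.
move=> yx uS h a b; rewrite (prefers_swap_adj yx) => /orP[/eqP[-> ->] //|].
by move=> /andP[_]; exact: uS.
Qed.

(* If [c] lies strictly between the two objects of an inversion, then [c] forms
   a tighter inversion with one of them. *)
Lemma adjacent_inversion P Q T y x : upper_set P T -> x \in T ->
  prefers P x y -> prefers Q y x ->
  exists y' x', [/\ adjacent Q y' x', prefers P x' y' & x' \in T].
Proof.
move=> uT.
have [n] := ubnP #|[set c | prefers Q y c && prefers Q c x]|.
elim: n y x => // n IH y x; rewrite ltnS => le_n xT pxy qyx.
have [c /andP[yc cx]|no] := pickP (fun c => prefers Q y c && prefers Q c x);
  last first.
  exists y, x; split=> //; split=> // -[c [yc cx]].
  by move: (no c); rewrite yc cx.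
have ncx : x != c by apply: contraTneq cx => ->; rewrite prefers_irr.
case/orP: (prefers_total P ncx) => [xc|pcx].
  apply: (IH c x) => //; apply: leq_trans le_n; apply/proper_card/properP.
  split; last by exists c; rewrite !inE ?yc ?cx // prefers_irr.
  apply/subsetP => z; rewrite !inE => /andP[cz ->].
  by rewrite (prefers_trans yc cz).
apply: (IH y c) => //; first last.
- exact: prefers_trans pxy.
- exact: uT xT.
apply: leq_trans le_n; apply/proper_card/properP.
split; last by exists c; rewrite !inE ?yc ?cx // prefers_irr andbF.
apply/subsetP => z; rewrite !inE => /andP[-> zc].
by rewrite (prefers_trans zc cx).
Qed.

(** Its cardinality is the Kendall tau distance between [P] and [Q]. *)
Definition inversions P Q : {set M * M} :=
  [set z | prefers P z.1 z.2 && prefers Q z.2 z.1].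

Lemma inversions_swap P Q y x : adjacent Q y x -> prefers P x y ->
  inversions P (swap Q y x) \proper inversions P Q.
Proof.
move=> yx pxy; have [qyx _] := yx; apply/properP; split.
  apply/subsetP => -[a b]; rewrite !inE /= => /andP[pab].
  rewrite pab (prefers_swap_adj yx) => /orP[/eqP[ex ey]|/andP[_ ->//]].
  by move: pab; rewrite ex ey (prefers_asym pxy).
exists (x, y); rewrite !inE /= pxy ?qyx // (prefers_swap_adj yx) eqxx /= orbF.
by rewrite xpair_eqE negb_and (adjacent_neq yx).
Qed.

End Preferences.

(** * One agent, other reports fixed: [f] and [g] stand for its rows under [phi] and [psi] *)

Section OneAgent.
Variables (R : realType) (M : finType) (f g : pref M -> M -> R).
Implicit Types (P Q : pref M) (S T : {set M}).

Hypothesis f_sum : forall Q, \sum_j f Q j = 1.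
Hypothesis f_sp : forall P Q u, consistent P u ->
  0 <= inner u (fun j => f P j - f Q j).

(** Stochastic dominance: adding [t] times the indicator of [S] to a consistent utility keeps it
    consistent, and for large [t] the sum over [S] decides the sign. *)
Lemma upper_sum_le P Q S : upper_set P S ->
  \sum_(j in S) f Q j <= \sum_(j in S) f P j.
Proof.
move=> uS; pose v j : R := #|[set k | prefers P j k]|%:R.
pose A := inner v (fun j => f P j - f Q j).
pose D := \sum_(j in S) (f P j - f Q j).
have AD t : 0 <= t -> 0 <= A + t * D.
  move=> t0; have cons : consistent P (fun j => v j + t * (j \in S)%:R).
    split=> [a|a b ab]; first by rewrite addr_ge0 ?mulr_ge0.
    apply: ltr_leD.
      rewrite ltr_nat; apply/proper_card/properP; split.
        by apply/subsetP => k; rewrite !inE; exact: prefers_trans.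
      by exists b; rewrite !inE ?prefers_irr.
    rewrite ler_wpM2l // ler_nat.
    by have := uS _ _ ab; case: (b \in S) => // ->.
  have := f_sp Q cons; congr (_ <= _); rewrite /inner /A /D /inner.
  rewrite [in RHS](big_mkcond (mem S)) mulr_sumr -big_split /=.
  apply: eq_bigr => j _; case: (j \in S) => /=; ring.
rewrite -subr_ge0 -sumrB -/D leNgt; apply/negP => D0.
have A0 : 0 <= A by have := AD 0 (lexx _); rewrite mul0r addr0.
(* This [t] would give [A + t * D = -1]. *)
have t0 : 0 <= (A + 1) / - D by rewrite divr_ge0 ?addr_ge0 // oppr_ge0 ltW.
have := AD _ t0.
have -> : A + (A + 1) / - D * D = -1 by field; rewrite lt_eqF.
by rewrite lerNr oppr0 ler10.
Qed.

(** * Effect of an adjacent swap on [f] *)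

Section Swap.
Variables (Q : pref M) (y x : M).
Hypothesis yx : adjacent Q y x.
Local Notation Q' := (swap Q y x).

(** [S] is an upper set of both orders, so dominance holds in both directions. *)
Lemma swap_upper_sum S : upper_set Q S -> (y \in S -> x \in S) ->
  \sum_(j in S) f Q' j = \sum_(j in S) f Q j.
Proof.
move=> uS h; apply/le_anti/andP.
by split; apply: upper_sum_le => //; exact: upper_swap.
Qed.

(** The objects above [j], with and without [j] itself, form upper sets that do not separate [y]
    from [x]; subtract their sums. *)
Lemma swap_other j : j != x -> j != y -> f Q' j = f Q j.
Proof.
move=> jx jy; set S := [set i | prefers Q i j].
have jS : j \notin S by rewrite inE prefers_irr.
have hS : y \in S -> x \in S by rewrite !inE (prefers_adjl yx).
have := swap_upper_sum (@upper_setU1_above _ Q j).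
rewrite !big_setU1 //= (swap_upper_sum (@upper_above _ Q j) hS) => E.
apply: (@addIr _ (\sum_(i in S) f Q i)); apply: E; rewrite !in_setU1 => /orP[|/hS ->]; last by rewrite orbT.
by rewrite eq_sym (negPf jy).
Qed.

(** In [Q'] the object [x] comes right after the objects above [y], whose total is unchanged;
    dominance at [Q'] then isolates [x]. *)
Lemma swap_sum_le : f Q x <= f Q' x.
Proof.
have [qyx _] := yx.
set S := [set i | prefers Q i y].
have yS : y \notin S by rewrite inE prefers_irr.
have xS : x \notin S by rewrite inE (prefers_asym qyx).
have uS : upper_set Q S by exact: upper_above.
have uS' : upper_set Q' (x |: S).
  move=> a b; rewrite (prefers_swap_adj yx) => /orP[/eqP[-> _ _]|].
    by rewrite setU11.
  move=> /andP[nab ab]; rewrite !in_setU1 => /orP[/eqP bx|/(uS _ _ ab) ->];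
    last by rewrite orbT.
  subst b; rewrite inE -(prefers_adjr yx) ?ab ?orbT //.
    by apply: contraTneq ab => ->; rewrite prefers_irr.
  by apply: contraNneq nab => ->.
have := upper_sum_le Q uS'; rewrite !big_setU1 //= swap_upper_sum ?lerD2r //.
by rewrite (negPf yS).
Qed.

(** The entry at [x] cannot fall, so it is fixed; the row sum then fixes the only other entry that
    could move, at [y]. *)
Lemma swap_const : f Q' x <= f Q x -> f Q' =1 f Q.
Proof.
move=> le; have ex : f Q' x = f Q x by apply/le_anti; rewrite le swap_sum_le.
have nyx := adjacent_neq yx.
move=> j; have [->//|jx] := eqVneq j x.
have [->|jy] := eqVneq j y; last exact: swap_other.
have := f_sum Q'; rewrite -(f_sum Q) (bigD1 y) //= [in RHS](bigD1 y) //=.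
under eq_bigr => i iy.
  rewrite (_ : f Q' i = f Q i); last first.
    by have [->//|ix] := eqVneq i x; exact: swap_other.
  over.
exact: addIr.
Qed.

End Swap.

(** * Agreement on an upper set passes from [f] to [g] *)

Hypothesis g_upper : forall Q Q', neighbor Q Q' -> forall a b,
  prefers Q a b -> prefers Q' b a -> forall j, prefers Q j a -> g Q j = g Q' j.
Hypothesis g_less_varying : forall Q Q', neighbor Q Q' ->
  f Q =1 f Q' -> g Q =1 g Q'.

(** Induction on the number of inversions, moving [Q] towards [P] by one adjacent swap at a time. *)
Lemma agree_upper P Q T : upper_set P T ->
  {in T, f P =1 f Q} -> {in T, g P =1 g Q}.
Proof.
move=> uT; have [n] := ubnP #|inversions P Q|.
elim: n Q => // n IH Q; rewrite ltnS => le_n fT.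
have IHs y x : adjacent Q y x -> prefers P x y ->
    {in T, f (swap Q y x) =1 f Q} -> {in T, g (swap Q y x) =1 g Q} ->
    {in T, g P =1 g Q}.
  move=> yx pxy ef eg j jT; rewrite -eg //; apply: IH jT.
    by apply: leq_trans le_n; apply/proper_card/inversions_swap.
  by move=> i iT; rewrite ef ?fT.
(* Stage one: some inversion has its [P]-better object in [T]. *)
have [[x y] /= /and3P[xT pxy qyx]|none] :=
    pickP (fun z => [&& z.1 \in T, prefers P z.1 z.2 & prefers Q z.2 z.1]).
  have [{pxy qyx}y' [{xT}x' [yx pxy xT]]] := adjacent_inversion uT xT pxy qyx.
  (* Above [x'] in [P] the swap leaves [f] equal to [f Q], hence to [f P]; dominance at [P] then
     keeps the entry at [x'] from rising. *)
  have ef : f (swap Q y' x') =1 f Q.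
    apply: (swap_const yx).
    have := upper_sum_le (swap Q y' x') (@upper_setU1_above _ P x').
    set S := [set j | _]; have xS : x' \notin S by rewrite inE prefers_irr.
    have ST j : j \in S -> j \in T by rewrite inE => /uT; exact.
    rewrite !big_setU1 //= fT // (eq_bigr (f Q)) => [|j jS].
      by rewrite [X in _ <= _ + X](eq_bigr (f Q)) ?lerD2r // => j /ST/fT.
    apply: swap_other => //.
      by apply: contraNneq xS => <-.
    by apply: contraTneq jS => ->; rewrite inE (prefers_asym pxy).
  apply: (IHs _ _ yx pxy) => [j _|j _]; first exact: ef.
  by apply/esym/(g_less_varying (neighbor_swap yx)) => i; rewrite ef.
(* Stage two: no inversion has its [P]-better object in [T], so [T] is on top of [Q] as well and the
   remaining swaps occur below it. *)
have uQT : upper_set Q T.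
  move=> a b ab bT; apply/negPn/negP => aT.
  have nab : a != b by apply: contraTneq ab => ->; rewrite prefers_irr.
  case/orP: (prefers_total P nab) => [/uT/(_ bT)|pba]; first exact/negP.
  by move: (none (b, a)); rewrite /= bT pba ab.
have [[x y] /= /andP[pxy qyx]|none'] :=
    pickP (fun z => prefers P z.1 z.2 && prefers Q z.2 z.1); last first.
  have -> // : P = Q; apply: pref_ext => a b pab.
  have nab : a != b by apply: contraTneq pab => ->; rewrite prefers_irr.
  case/orP: (prefers_total Q nab) => // qba.
  by move: (none' (a, b)); rewrite /= pab qba.
have uPT : upper_set P [set: M] by move=> a b _ _; rewrite inE.
have [{pxy qyx}y' [{}x [yx pxy _]]] :=
  adjacent_inversion uPT (in_setT x) pxy qyx.
move: y' yx pxy => {}y yx pxy; have [qyx _] := yx.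
have xT : x \notin T by apply/negP => xT; move: (none (x, y)); rewrite /= xT pxy qyx.
have yT : y \notin T by apply: contra xT; exact: uT.
apply: (IHs _ _ yx pxy) => j jT.
  by apply: swap_other => //; [apply: contraNneq xT|apply: contraNneq yT] => <-.
apply/esym/(g_upper (neighbor_swap yx) qyx).
  by rewrite (prefers_swap_adj yx) eqxx.
have njy : j != y by apply: contraNneq yT => <-.
by case/orP: (prefers_total Q njy) => // /uQT/(_ jT) yT'; rewrite yT' in yT.
Qed.

(** * A safe hybrid weight for a single misreport *)

Hypothesis g_sum : forall Q, \sum_j g Q j = 1.

(** Take the [P]-best object where the rows differ; dominance gives the sign. It is not the worst
    object, since the row sums would then force equality there; [l] later ensures that [u k] exceeds
    the minimum of [u]. *)
Lemma first_difference P Q : ~ (f P =1 f Q) ->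
  exists k, [/\ f Q k < f P k, forall j, prefers P j k -> f P j = f Q j
            & exists l, prefers P k l].
Proof.
move=> nfPQ.
have [k0 nk0] : exists k, f P k != f Q k.
  by apply: contra_notP nfPQ => h j; apply/eqP/negPn/negP => nj; apply: h; exists j.
have [k nk kmin] := @arg_minnP _ k0 (fun k => f P k != f Q k) (rank P) nk0.
have eqk j : prefers P j k -> f P j = f Q j.
  move=> jk; apply/eqP/negPn/negP => /kmin.
  by rewrite leqNgt rank_lt.
exists k; split=> //.
  rewrite lt_def nk /=; have := upper_sum_le Q (@upper_setU1_above _ P k).
  rewrite !big_setU1 ?inE ?prefers_irr //=.
  by rewrite [X in _ <= _ + X](eq_bigr (f Q)) ?lerD2r // => j; rewrite inE => /eqk.
have [l kl|nol] := pickP (prefers P k); first by exists l.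
case/negP: nk; apply/eqP.
have := f_sum P; rewrite -(f_sum Q) (bigD1 k) //= [in RHS](bigD1 k) //=.
rewrite (eq_bigr (f Q)) => [|j jk]; first exact: addIr.
by apply: eqk; have := prefers_total P jk; rewrite nol orbF.
Qed.

Lemma hybrid_weight P Q (r : R) : 0 <= r < 1 ->
  exists b : R, 0 < b <= 1 /\ forall beta, 0 <= beta <= b ->
    forall u, consistent P u -> URBI r P u ->
    0 <= inner u (fun j => (1 - beta) * (f P j - f Q j) + beta * (g P j - g Q j)).
Proof.
move=> /andP[r0 r1].
have [fPQ|/first_difference[k [dk0 dk [l kl]]]] := pselect (f P =1 f Q).
  exists 1; rewrite ltr01 lexx; split=> // beta _ u _ _.
  apply: sumr_ge0 => j _.
  have -> : g P j = g Q j by apply: (@agree_upper P Q setT); rewrite ?inE // => *; rewrite ?inE.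
  by rewrite fPQ !subrr !mulr0 addr0 mulr0.
pose d j := f P j - f Q j; pose e j := g P j - g Q j.
have ek j : prefers P j k -> e j = 0.
  move=> jk; apply/eqP; rewrite subr_eq0; apply/eqP.
  apply: (@agree_upper P Q [set i | prefers P i k]); rewrite ?inE //.
    exact: upper_above.
  by move=> i; rewrite inE => /dk.
pose C := \sum_j `|e j|; pose K := (1 - r) / 2 * d k.
have C0 : 0 <= C by apply: sumr_ge0.
have K0 : 0 < K by rewrite mulr_gt0 ?divr_gt0 ?subr_gt0.
(* This weight [b] solves [(1 - b) * K = b * C]: in units of [w k], [K] bounds the loss under [f]
   from below and [C] the gain under [g] from above. *)
exists (K / (K + C)); split.
  by rewrite divr_gt0 ?ltr_wpDr //= ler_pdivrMr ?ltr_wpDr // mul1r lerDl.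
move=> beta /andP[b0]; rewrite ler_pdivlMr ?ltr_wpDr // => bK u [u0 uP] uU.
have [m um] : exists m, forall j, u m <= u j.
  by case: (@arg_minP _ _ _ k xpredT u isT) => m _ h; exists m => j; exact: h.
move/(URBI_minE r P (erefl (u m)) um): uU => uU.
pose w j := u j - u m.
have w0 j : 0 <= w j by rewrite subr_ge0.
have wk : 0 < w k by rewrite subr_gt0 (le_lt_trans (um l)) ?uP.
(* URBI leaves a gap of at least [(1 - r) * w k] below [u k]. Lowering [u k] by half of it keeps [u]
   consistent, and strategyproofness for the lowered utility bounds the loss. *)
pose s := (1 - r) / 2 * w k.
have s0 : 0 <= s by rewrite mulr_ge0 ?divr_ge0 ?subr_ge0 // ltW.
have ud : s * d k <= inner u d.
  have cons : consistent P (fun j => u j - s * (j == k)%:R).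
    split=> [a|a b ab].
      case: eqP => [->|_]; rewrite ?mulr0 ?subr0 // mulr1.
      by have := u0 m; rewrite /s /w; move: wk; rewrite /w; nra.
    have uab := uP _ _ ab.
    have [ak|nak] := eqVneq a k; last first.
      rewrite mulr0 subr0; apply: le_lt_trans uab.
      by rewrite gerBl mulr_ge0.
    have -> : b == k = false.
      by apply: contraTF ab => /eqP ->; rewrite ak prefers_irr.
    have := uU _ _ ab; rewrite ak mulr0 mulr1 subr0 /s; move: wk; rewrite /w; nra.
  have := f_sp Q cons.
  suff -> : inner (fun j => u j - s * (j == k)%:R) d = inner u d - s * d k.
    by rewrite subr_ge0.
  rewrite /inner; under eq_bigr do rewrite mulrBl.
  rewrite sumrB; congr (_ - _).
  rewrite (bigD1 k) //= eqxx mulr1 big1 ?addr0 // => j /negPf ->.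
  by rewrite mulr0 mul0r.
(* Since [e] sums to zero, [u] may be replaced by [w]; where [e] can be nonzero, [w] is at most
   [w k]. *)
have ue : - (w k * C) <= inner u e.
  have e0 : \sum_j e j = 0 by rewrite sumrB !g_sum subrr.
  rewrite -(inner_shift u (u m) e0) /inner /C mulr_sumr -sumrN.
  apply: ler_sum => j _; rewrite -/(w j).
  have [jk|njk] := boolP (prefers P j k); first by rewrite ek // normr0 !mulr0 oppr0.
  have wjk : w j <= w k.
    have [->//|nk] := eqVneq j k; rewrite lerD2r ltW // uP //.
    by have := prefers_total P nk; rewrite (negPf njk).
  rewrite lerNl -mulrN; apply: (@le_trans _ _ (w j * `|e j|)).
    by rewrite ler_wpM2l // -normrN ler_norm.
  by rewrite ler_wpM2r.
have -> : inner u (fun j => (1 - beta) * (f P j - f Q j) + beta * (g P j - g Q j))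
    = (1 - beta) * inner u d + beta * inner u e.
  rewrite /inner !mulr_sumr -big_split; apply: eq_bigr => j _ /=.
  by rewrite /d /e; ring.
have b1 : beta <= 1 by nra.
apply: (@le_trans _ _ ((1 - beta) * (s * d k) + beta * - (w k * C))).
  have -> : (1 - beta) * (s * d k) + beta * - (w k * C) =
     w k * (K - beta * (K + C)) by rewrite /s /K; ring.
  by rewrite mulr_ge0 ?subr_ge0 // ltW.
by rewrite lerD // ler_wpM2l // subr_ge0.
Qed.

End OneAgent.

(** * From single misreports to the whole mechanism *)

(** Each condition holds on an interval starting at 0, so the minimum of the finitely many bounds
    works; the default 1 covers an empty [T]. *)
Lemma uniform_weight (R : realType) (T : finType) (A : T -> R -> Prop) :
  (forall t, exists b, 0 < b <= 1 /\ forall c, 0 <= c <= b -> A t c) ->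
  exists b, 0 < b <= 1 /\ forall t, A t b.
Proof.
move=> /choice[b hb]; exists (\big[Num.min/1]_t b t).
have b0 : 0 < \big[Num.min/1]_t b t.
  by apply/bigmin_gtP; split=> // t _; have [/andP[]] := hb t.
split; first by rewrite b0; apply: bigmin_le_id.
by move=> t; have [_] := hb t; apply; rewrite ltW //=; apply: bigmin_le.
Qed.

Section Deviations.
Variables (N M : finType).
Implicit Types (p : profile N M) (P : pref M).

Lemma deviate_at p i P : deviate p i P i = P.
Proof. by rewrite ffunE eqxx. Qed.

Lemma deviate_id p i : deviate p i (p i) = p.
Proof. by apply/ffunP => k; rewrite ffunE; case: eqP => [->|]. Qed.

Lemma deviate_deviate p i P P' : deviate (deviate p i P) i P' = deviate p i P'.
Proof. by apply/ffunP => k; rewrite !ffunE; case: eqP. Qed.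

End Deviations.

Lemma hybrid_psp_exists (R : realType) (N M : finType) (q : M -> nat)
    (phi psi : profile N M -> N -> M -> R) (r : R) :
  mechanism q phi -> mechanism q psi -> hybrid_admissible phi psi ->
  0 <= r < 1 ->
  exists beta : R, 0 < beta <= 1 /\ partially_strategyproof r (hybrid beta phi psi).
Proof.
move=> mphi mpsi [sp ui lv] r01.
have [|beta [beta01 hb]] := @uniform_weight R (N * profile N M * pref M)%type
  (fun t beta => forall u, consistent (t.1.2 t.1.1) u -> URBI r (t.1.2 t.1.1) u ->
    no_gain (hybrid beta phi psi) t.1.1 t.1.2 t.2 u); last first.
  by exists beta; split=> //; right=> i p P'; exact: (hb (i, p, P')).
move=> [[i p] P'] /=.
pose f Q := phi (deviate p i Q) i; pose g Q := psi (deviate p i Q) i.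
have [||||| b [b01 hb]] := @hybrid_weight R M f g _ _ _ _ _ (p i) P' r r01.
- by move=> Q; have [_ ->] := mphi (deviate p i Q).
- move=> P Q u cu; have := sp i (deviate p i P) Q u.
  by rewrite /no_gain deviate_at deviate_deviate; exact.
- move=> Q Q'; have := ui i (deviate p i Q) Q'.
  by rewrite deviate_at deviate_deviate.
- move=> Q Q'; have := lv i (deviate p i Q) Q'.
  by rewrite deviate_at deviate_deviate.
- by move=> Q; have [_ ->] := mpsi (deviate p i Q).
exists b; split=> // c cb u cu ur; have := hb c cb u cu ur.
rewrite /no_gain /f /g deviate_id; congr (_ <= inner _ _).
by apply/funext => j; rewrite /hybrid; ring.
Qed.

(** With [t = beta / beta'], the [beta]-hybrid is the mixture of [phi] and the [beta']-hybrid with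
    weights [1 - t] and [t]; neither component allows a gain. *)
Lemma hybrid_psp_le (R : realType) (N M : finType)
    (phi psi : profile N M -> N -> M -> R) (r beta beta' : R) :
  strategyproof phi -> 0 <= beta <= beta' ->
  partially_strategyproof r (hybrid beta' phi psi) ->
  partially_strategyproof r (hybrid beta phi psi).
Proof.
move=> sp /andP[b0 bb'] [->|h]; [by left|right=> i p P' u cu ur].
have [b'0|nb'0] := eqVneq beta' 0.
  by have -> : beta = beta' by [apply/le_anti; rewrite bb' b'0]; exact: h.
have b'p : 0 < beta' by rewrite lt_def nb'0 (le_trans b0).
pose t := beta / beta'.
have t0 : 0 <= t by rewrite divr_ge0 // ltW.
have t1 : t <= 1 by rewrite ler_pdivrMr // mul1r.
have := addr_ge0 (mulr_ge0 (_ : 0 <= 1 - t) (sp i p P' u cu))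
  (mulr_ge0 t0 (h i p P' u cu ur)).
rewrite subr_ge0 => /(_ t1); congr (_ <= _).
rewrite /inner !mulr_sumr -big_split; apply: eq_bigr => j _ /=.
by rewrite /hybrid /t; field.
Qed.

Theorem theorem1 (R : realType) (N M : finType) (q : M -> nat)
  (q_gt0 : forall j : M, (0 < q j)%N)
  (q_enough : (#|N| <= \sum_(j : M) q j)%N)
  (phi psi : profile N M -> N -> M -> R)
  (phi_mech : mechanism q phi) (psi_mech : mechanism q psi)
  (adm : hybrid_admissible phi psi) :
  (forall r : R, 0 <= r < 1 ->
     exists beta : R, 0 < beta <= 1 /\
       partially_strategyproof r (hybrid beta phi psi)) /\
  (forall beta beta' : R, 0 <= beta -> beta <= beta' -> beta' <= 1 ->
     degree (hybrid beta' phi psi) <= degree (hybrid beta phi psi)).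
Proof.
split=> [r r01|beta beta' b0 bb' b'1].
  exact: hybrid_psp_exists phi_mech psi_mech adm r01.
have [sp _ _] := adm.
have mech b : 0 <= b -> b <= 1 -> mechanism q (hybrid b phi psi).
  by move=> h0 h1; apply: hybrid_mechanism; rewrite ?h0.
(* The degree at [beta'] is attained, so it is itself a level that passes down to [beta]. *)
have [[d01 hd] _] := degree_max (mech _ (le_trans b0 bb') b'1).
have [_] := degree_max (mech _ b0 (le_trans bb' b'1)); apply; split=> //.
by apply: hybrid_psp_le hd => //; rewrite b0.
Qed.
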